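(* Consider the following four frame conditions on models, each with a corresponding axiom schema: (NEC) condition: $W\in\mathcal{N}_i(w)$ for all $i\in I$, $w\in W$; axioms: $\square_i\top$ for all $i\in I$; (CONEC) condition: $W\notin\mathcal{N}_i(w)$ for all $i\in I$, $w\in W$; axioms: $\neg\square_i\top$ for all $i\in I$; (P) condition: $\emptyset\notin\mathcal{N}_i(w)$ for all $i\in I$, $w\in W$; axioms: $\neg\square_i\bot$ for all $i\in I$; (COP) condition: $\emptyset\in\mathcal{N}_i(w)$ for all $i\in I$, $w\in W$; axioms: $\square_i\bot$ for all $i\in I$. For every subset $S\subseteq\{\mathrm{NEC},\mathrm{CONEC},\mathrm{P},\mathrm{COP}\}$, the logic of the class of all models satisfying all the frame conditions in $S$ is axiomatized by adding to $\mathbf{B}$ the axioms corresponding to the members of $S$.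
   Context: Fix a (finite or infinite) index set $I$ and a countable set $\mathfrak{P}$ of propositional variables. A group is a non-empty finite subset of $I$; $G,H,J$ always range over groups. Language: $\mathfrak{L}$ is generated from $\mathfrak{P}$ and the constants $\bot,\top$ by the classical connectives ($\bot,\neg,\vee$ primitive, the others and $\top$ defined as usual) and the unary modal operators $\square_G$, one for each group $G$. Write $\square_i$ for $\square_{\{i\}}$. Models: a model is $\mathfrak{M}=\langle W,\langle\mathcal{N}_i\rangle_{i\in I},V\rangle$ with $W\neq\emptyset$, $\mathcal{N}_i:W\to\wp(\wp(W))$ for each $i\in I$, and $V:\mathfrak{P}\to\wp(W)$. For a group $G=\{i_1,\ldots,i_n\}$, $\mathcal{N}_G(w)=\{X_{i_1}\cap\cdots\cap X_{i_n}\mid X_{i_j}\in\mathcal{N}_{i_j}(w)\text{ for each }j\}$. Truth at a world is defined as usual for variables and classical connectives, and $\mathfrak{M},w\models\square_G\varphi$ iff $\|\varphi\|^{\mathfrak{M}}\in\mathcal{N}_G(w)$, where $\|\varphi\|^{\mathfrak{M}}=\{w\in W\mid\mathfrak{M},w\models\varphi\}$. For a class of models, $\Gamma\Vdash\varphi$ means: at every world of every model in the class at which all members of $\Gamma$ are true, $\varphi$ is true. The base system $\mathbf{B}$ consists of any sound and complete axiomatization of classical propositional logic, all instances in $\mathfrak{L}$ of (B1) $(\square_G\varphi\wedge\square_H\psi)\rightarrow\square_{G\cup H}(\varphi\wedge\psi)$, where $G\cap H=\emptyset$; (B2) $\square_{G\cup H}\top\rightarrow\square_G\top$; (B3) $(\square_G\varphi\wedge\square_{G\cup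 H\cup J}\varphi)\rightarrow\square_{G\cup H}\varphi$; (B4) $(\square_G\varphi\wedge\square_H(\varphi\vee\psi))\rightarrow\square_{G\cup H}\varphi$; and the rules (RE) if $\varphi\vdash\psi$ and $\psi\vdash\varphi$, then $\square_G\varphi\vdash\square_G\psi$; (MP) if $\vdash\varphi$ and $\vdash\varphi\rightarrow\psi$, then $\vdash\psi$. Systems obtained by adding axioms keep both rules. A theorem of a system is a formula derivable from its axioms by the rules; $\Gamma\vdash\varphi$ iff there are $\psi_1,\ldots,\psi_n\in\Gamma$ ($n\ge 0$) such that $(\psi_1\wedge\cdots\wedge\psi_n)\rightarrow\varphi$ is a theorem. The logic of a class of models is axiomatized by a system if the system is sound and strongly complete for the class: for all $\Gamma\subseteq\mathfrak{L}$, $\varphi\in\mathfrak{L}$, $\Gamma\vdash\varphi$ iff $\Gamma\Vdash\varphi$ over the class. *)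

(* Defs.v *)
From mathcomp Require Import all_boot finmap.
From mathcomp Require Import boolp classical_sets.
From Stdlib Require List.

Set Implicit Arguments.
Unset Strict Implicit.
Unset Printing Implicit Defensive.

Local Open Scope classical_set_scope.

Definition group (I : choiceType) := {G : {fset I} | G != fset0}.

Section Groups.
Variable I : choiceType.
Implicit Types G H : group I.

Lemma group1_proof (i : I) : [fset i]%fset != fset0.
Proof. by apply/fset0Pn; exists i; rewrite in_fset1. Qed.

Lemma groupU_proof G H : (val G `|` val H)%fset != fset0.
Proof. by rewrite fsetU_eq0 negb_and (valP G). Qed.

Definition group1 (i : I) : group I :=
  exist (fun G : {fset I} => G != fset0) _ (group1_proof i).
Definition groupU G H : group I :=
  exist (fun G : {fset I} => G != fset0) _ (groupU_proof G H).

End Groups.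

Inductive formula (P : countType) (I : choiceType) : Type :=
| Var of P
| Bot
| Neg of formula P I
| Or of formula P I & formula P I
| Box of group I & formula P I.

Arguments Var {P I}.
Arguments Bot {P I}.

Section Syntax.
Variables (P : countType) (I : choiceType).
Local Notation formula := (formula P I).
Implicit Types (phi psi : formula) (G H J : group I) (i : I).

Definition Top : formula := Neg Bot.
Definition And phi psi : formula := Neg (Or (Neg phi) (Neg psi)).
Definition Imp phi psi : formula := Or (Neg phi) psi.
Definition Conj (s : seq formula) : formula := foldr And Top s.

(* Boxed formulas count as atoms: [v] is arbitrary on them. *)
Definition boolean_valuation (v : formula -> bool) : Prop :=
  [/\ v Bot = false,
      forall phi, v (Neg phi) = ~~ v phi &
      forall phi psi, v (Or phi psi) = v phi || v psi].

Definition tautology phi : Prop :=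
  forall v, boolean_valuation v -> v phi.

Inductive mp_closure (A : set formula) : formula -> Prop :=
| mp_ax phi : A phi -> mp_closure A phi
| mp_mp phi psi :
    mp_closure A phi -> mp_closure A (Imp phi psi) -> mp_closure A psi.

(* [A] is a sound and complete axiomatization (modus ponens being the only
   rule) of classical propositional logic, instantiated to the modal language *)
Definition cpl_axiomatization (A : set formula) : Prop :=
  forall phi, mp_closure A phi <-> tautology phi.

Inductive B_axiom (CPL : set formula) : formula -> Prop :=
| B0 phi : CPL phi -> B_axiom CPL phi
| B1 G H phi psi : (val G `&` val H)%fset = fset0 ->
    B_axiom CPL
      (Imp (And (Box G phi) (Box H psi)) (Box (groupU G H) (And phi psi)))
| B2 G H : B_axiom CPL (Imp (Box (groupU G H) Top) (Box G Top))
| B3 G H J phi :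
    B_axiom CPL
      (Imp (And (Box G phi) (Box (groupU (groupU G H) J) phi))
           (Box (groupU G H) phi))
| B4 G H phi psi :
    B_axiom CPL
      (Imp (And (Box G phi) (Box H (Or phi psi))) (Box (groupU G H) phi)).

(* In [th_RE], [phi |- psi] is rendered as theoremhood of [phi -> psi]. *)
Inductive is_theorem (A : set formula) : formula -> Prop :=
| th_ax phi : A phi -> is_theorem A phi
| th_RE G phi psi :
    is_theorem A (Imp phi psi) -> is_theorem A (Imp psi phi) ->
    is_theorem A (Imp (Box G phi) (Box G psi))
| th_MP phi psi :
    is_theorem A phi -> is_theorem A (Imp phi psi) -> is_theorem A psi.

Definition derives (A Gamma : set formula) phi : Prop :=
  exists2 s : seq formula,
    List.Forall Gamma s & is_theorem A (Imp (Conj s) phi).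

End Syntax.

Record model (P : countType) (I : choiceType) := Model {
  world :> Type;
  world_inhabited : inhabited world;
  nbhd : I -> world -> set (set world);
  val_var : P -> set world }.

Section Semantics.
Variables (P : countType) (I : choiceType).
Local Notation formula := (formula P I).
Local Notation model := (model P I).

(* The values of [X] outside [G] are irrelevant. *)
Definition group_nbhd (M : model) (G : group I) (w : M) : set (set M) :=
  [set Y | exists2 X : I -> set M,
     (forall i, i \in val G -> nbhd i w (X i)) &
     Y = \bigcap_(i in [set i | i \in val G]) X i].

Fixpoint sat (M : model) (w : M) (phi : formula) : Prop :=
  match phi with
  | Var p => val_var p w
  | Bot => False
  | Neg phi => ~ sat w phi
  | Or phi psi => sat w phi \/ sat w psi
  | Box G phi => group_nbhd G w [set v | sat v phi]
  end.

(* Classes of models are not of type [set model]: [set] is not universe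
   polymorphic, so worlds could then not themselves be built from sets. *)
Definition consequence (C : model -> Prop) (Gamma : set formula)
    (phi : formula) : Prop :=
  forall M, C M -> forall w : M,
    (forall psi, Gamma psi -> sat w psi) -> sat w phi.

Definition axiomatized_by (C : model -> Prop) (A : set formula) : Prop :=
  forall (Gamma : set formula) (phi : formula),
    derives A Gamma phi <-> consequence C Gamma phi.

End Semantics.

Inductive condition := cNEC | cCONEC | cP | cCOP.

Definition frame_condition (P : countType) (I : choiceType) (c : condition)
    (M : model P I) : Prop :=
  forall (i : I) (w : M),
    match c with
    | cNEC => nbhd i w setT
    | cCONEC => ~ nbhd i w setT
    | cP => ~ nbhd i w set0
    | cCOP => nbhd i w set0
    end.

Definition condition_axiom (P : countType) (I : choiceType) (c : condition)
    (i : I) : formula P I :=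
  match c with
  | cNEC => Box (group1 i) (Top P I)
  | cCONEC => Neg (Box (group1 i) (Top P I))
  | cP => Neg (Box (group1 i) Bot)
  | cCOP => Box (group1 i) Bot
  end.

Definition model_class (P : countType) (I : choiceType) (S : set condition) :
    model P I -> Prop :=
  fun M => forall c, S c -> frame_condition c M.

Definition extended_system (P : countType) (I : choiceType)
    (CPL : set (formula P I)) (S : set condition) : set (formula P I) :=
  B_axiom CPL `|`
    [set phi | exists2 c, S c & exists i, phi = condition_axiom P c i].

(* Main.v *)
Require Import Defs.
From mathcomp Require Import all_boot finmap.
From mathcomp Require Import boolp classical_sets.

(** Soundness is a computation with neighbourhoods. Completeness comes from one
    canonical model that serves all sets of frame conditions at once.

    The obstacle is that [Box G phi] may lie in a maximal consistent set [D]
    while no box of a smaller group does, so the members of [G] must be given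
    neighbourhoods that intersect exactly in the truth set of [phi], without
    letting other groups form truth sets of formulas that [D] does not box for
    them. To that end a world is a pair of a maximal consistent set and a
    selector [f], which names one member [f (G, phi)] of [G] for every pair
    [(G, phi)]. For every [Box G phi] in [D] and [i] in [G], agent [i] gets
    the neighbourhood
      [component i (G, phi)] = { worlds where [phi] holds or [f (G, phi) <> i] }.
    Since [f (G, phi)] lies in [G], these intersect over [G] in the truth set
    of [phi]; since it can be any member of [G], an intersection over fewer
    members is cut down to the truth set of [phi] by some selectors and not at
    all by others.

    Conversely ([box_of_components]), suppose that the members [i] of [H] pick
    components [(G_i, phi_i)] with [Box G_i phi_i] in [D], and that these
    intersect in the truth set of [psi]. Call [i] complete if all of [G_i] lies
    in [H] and picks the same component as [i]. A selector that avoids the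
    picking members wherever possible shows that the [phi_i] with [i] complete
    together entail [psi]; a selector with [f (G_i, phi_i) = i] shows that
    [psi] entails [phi_i], for every [i] in [H]. Groups of complete members
    coincide with their formula or are disjoint, so (B1) gives [Box K psi] for
    the union [K] of these groups, which is contained in [H]. By (B4) all
    [G_i] may be joined to [K], which yields a group [G] that contains [H] with
    [Box G psi], and (B3) interpolates [Box H psi] between the two. If no
    member is complete then [psi] is a theorem, as are all [phi_i], and (B2)
    takes the place of (B3).

    Hence truth and membership agree ([truth]). Each frame condition says that
    its axioms are true at all worlds ([condition_axiomP]), and axioms belong to
    all maximal consistent sets, so the canonical model lies in the intended
    class whatever conditions are chosen. *)

Set Implicit Arguments.
Unset Strict Implicit.
Unset Printing Implicit Defensive.

Local Open Scope classical_set_scope.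

(** * Soundness *)

Section Soundness.
Variables (P : countType) (I : choiceType).
Implicit Types (phi psi : formula P I) (G H : group I) (M : model P I).

Lemma sat_Top M (w : M) : sat w (Top P I).
Proof. by move=> /=. Qed.

Lemma sat_And M (w : M) phi psi :
  sat w (And phi psi) <-> sat w phi /\ sat w psi.
Proof.
split=> /= [nor | [sphi spsi] []]; last by [].
  by split; apply: contrapT => nsat; apply: nor; [left | right].
by [].
Qed.

Lemma sat_Imp M (w : M) phi psi :
  sat w (Imp phi psi) <-> (sat w phi -> sat w psi).
Proof.
split=> /= [[//|spsi _ //] | imp].
by have [sphi|nphi] := pselect (sat w phi); [right; apply: imp | left].
Qed.

Lemma sat_Conj M (w : M) (s : seq (formula P I)) :
  List.Forall (sat w) s -> sat w (Conj s).
Proof.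
elim=> [|phi t sphi _ IH]; first exact: sat_Top.
by apply/sat_And.
Qed.

Lemma sat_valuation M (w : M) : boolean_valuation (fun phi => `[< sat w phi >]).
Proof.
split=> [|phi|phi psi] /=; first exact/asboolF.
- by rewrite -asbool_neg.
- by rewrite -asbool_or.
Qed.

Lemma tautology_sat M (w : M) phi : tautology phi -> sat w phi.
Proof. by move=> /(_ _ (sat_valuation w)) /asboolP. Qed.

(** Disjointness lets the two choices of neighbourhoods be glued into one;
    this is (B1). *)
Lemma group_nbhdU_disjoint M (w : M) G H (A B : set M) :
  (val G `&` val H)%fset = fset0 ->
  group_nbhd G w A -> group_nbhd H w B -> group_nbhd (groupU G H) w (A `&` B).
Proof.
move=> dGH [X NX ->] [Y NY ->].
exists (fun i => if i \in val G then X i else Y i) => [i|].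
  rewrite in_fsetU; case: ifP => [iG _ | _ /= iH]; [exact: NX | exact: NY].
apply/seteqP; split=> v.
  case=> vX vY i /=; rewrite in_fsetU.
  by case: ifP => [iG _|_ /=]; [exact: vX | exact: vY].
move=> vZ; split=> i /= iG.
  by have := vZ i; rewrite /= in_fsetU iG; apply.
have := vZ i; rewrite /= in_fsetU iG orbT.
case: ifP => [iG' _|_]; last by apply.
have : i \in (val G `&` val H)%fset by rewrite in_fsetI iG' iG.
by rewrite dGH.
Qed.

(** Members of [H] outside [G] may contribute any neighbourhood containing
    [A], which does not change the intersection; (B3) and (B4) are both
    instances. *)
Lemma group_nbhd_absorb M (w : M) G H (A : set M) :
  group_nbhd G w A ->
  (forall i, i \in val H -> exists2 Z, nbhd i w Z & A `<=` Z) ->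
  group_nbhd (groupU G H) w A.
Proof.
move=> [X NX AE] HZ.
have [i|Y NY] :=
    @choice _ _ (fun i Z => i \in val H -> nbhd i w Z /\ A `<=` Z).
  have [/HZ[Z NZ AZ]|_] := boolP (i \in val H); first by exists Z.
  by exists setT.
exists (fun i => if i \in val G then X i else Y i) => [i|].
  rewrite in_fsetU; case: ifP => [iG _|_ /= /NY[]//]; exact: NX.
apply/seteqP; split=> v.
  move=> Av i /=; rewrite in_fsetU; case: ifP => [iG _|_ /= /NY[_]]; last exact.
  by move: Av; rewrite AE; apply.
move=> vZ; rewrite AE => i /= iG.
by have := vZ i; rewrite /= in_fsetU iG; apply.
Qed.

Lemma group_nbhd_sup M (w : M) G (A : set M) i :
  group_nbhd G w A -> i \in val G -> exists2 Z, nbhd i w Z & A `<=` Z.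
Proof.
by move=> [X NX ->] iG; exists (X i); [exact: NX | exact: bigcap_inf].
Qed.

Lemma group_nbhd_setT M (w : M) G H :
  group_nbhd (groupU G H) w setT -> group_nbhd G w setT.
Proof.
move=> [X NX XT]; exists X => [i iG|].
  by apply: NX; rewrite in_fsetU iG.
apply/esym/seteqP; split=> // v _ i /= iG.
have : setT v by [].
by rewrite XT; apply; rewrite /= in_fsetU iG.
Qed.

Lemma group_nbhd1 M (w : M) i (A : set M) :
  group_nbhd (group1 i) w A <-> nbhd i w A.
Proof.
have dom : [set j | j \in val (group1 i)] = [set i].
  by apply/seteqP; split=> j /=; rewrite in_fset1 => /eqP.
split=> [[X NX]|NA].
  by rewrite dom bigcap_set1 => ->; apply: NX; rewrite in_fset1.
exists (fun=> A) => [j|]; first by rewrite in_fset1 => /eqP->.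
by rewrite dom bigcap_set1.
Qed.

Lemma truth_set_ext M phi psi :
  (forall v : M, sat v phi <-> sat v psi) ->
  [set v : M | sat v phi] = [set v | sat v psi].
Proof. by move=> e; apply/seteqP; split=> v /e. Qed.

Lemma truth_set_Top M : [set v : M | sat v (Top P I)] = setT.
Proof. by apply/seteqP; split=> // v _; apply: sat_Top. Qed.

Lemma truth_set_Bot M : [set v : M | sat v (@Bot P I)] = set0.
Proof. by apply/seteqP; split. Qed.

(** Each condition speaks only of truth sets of closed formulas, so it can be
    transferred to any model in which its axioms are true everywhere; no
    construction specific to the condition is then needed. *)
Lemma condition_axiomP M c :
  frame_condition c M <-> forall i (w : M), sat w (condition_axiom P c i).
Proof.
by case: c; split=> h i w; have := h i w;
  rewrite /= ?truth_set_Top ?truth_set_Bot group_nbhd1.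
Qed.

Lemma B_axiom_sound (CPL : set (formula P I)) M (w : M) phi :
  cpl_axiomatization CPL -> B_axiom CPL phi -> sat w phi.
Proof.
move=> cpl [chi | G H chi psi dGH | G H | G H J chi | G H chi psi].
- by move=> /(@mp_ax _ _ _ _)/cpl; apply: tautology_sat.
- apply/sat_Imp => /sat_And[/= sG sH].
  rewrite (_ : [set _ | _] = [set v | sat v chi] `&` [set v | sat v psi]).
    exact: group_nbhdU_disjoint.
  by apply/seteqP; split=> v /sat_And.
- apply/sat_Imp; rewrite /= truth_set_Top; exact: group_nbhd_setT.
- apply/sat_Imp => /sat_And[/= sG sJ]; apply: group_nbhd_absorb => // i iH.
  by apply: group_nbhd_sup sJ _; rewrite !in_fsetU iH orbT.
- apply/sat_Imp => /sat_And[/= sG sH]; apply: group_nbhd_absorb => // i iH.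
  have [Z NZ sZ] := group_nbhd_sup sH iH.
  by exists Z => // v sv; apply: sZ; left.
Qed.

Lemma theorem_sound (CPL : set (formula P I)) S M phi :
  cpl_axiomatization CPL -> model_class S M ->
  is_theorem (extended_system CPL S) phi -> forall w : M, sat w phi.
Proof.
move=> cpl SM; elim=> {phi}
  [phi ax | G phi psi _ IH1 _ IH2 | phi psi _ IH1 _ IH2] w.
- case: ax => [|[c Sc [i ->]]]; first exact: B_axiom_sound.
  exact: (@condition_axiomP M c).1 (SM c Sc) i w.
- apply/sat_Imp => /=.
  by rewrite (@truth_set_ext _ phi psi) // => v; split; apply/sat_Imp.
- by move/sat_Imp: (IH2 w); apply.
Qed.

Lemma derives_sound (CPL : set (formula P I)) S Gamma phi :
  cpl_axiomatization CPL -> derives (extended_system CPL S) Gamma phi ->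
  consequence (model_class S) Gamma phi.
Proof.
move=> cpl [s Gs thm] M SM w GammaW.
have /sat_Imp := theorem_sound cpl SM thm w; apply.
by apply: sat_Conj; apply: List.Forall_impl Gs.
Qed.

End Soundness.

(** * Maximal consistent sets *)

Section MaximalConsistent.
Variables (P : countType) (I : choiceType) (L : set (formula P I)).
Hypothesis tautology_theorem : forall phi, tautology phi -> is_theorem L phi.
Implicit Types (phi psi chi : formula P I) (Gamma D : set (formula P I)).
Implicit Types (v : formula P I -> bool) (s : seq (formula P I)).

Lemma valuation_Imp v phi psi :
  boolean_valuation v -> v (Imp phi psi) = (v phi ==> v psi).
Proof. by case=> _ vN vO; rewrite vO vN implybE. Qed.

Lemma valuation_And v phi psi :
  boolean_valuation v -> v (And phi psi) = v phi && v psi.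
Proof. by case=> _ vN vO; rewrite vN vO !vN negb_or !negbK. Qed.

Lemma valuation_Top v : boolean_valuation v -> v (Top P I).
Proof. by case=> vB vN _; rewrite vN vB. Qed.

Lemma valuation_Conj v s : boolean_valuation v -> v (Conj s) = all v s.
Proof.
move=> bv; elim: s => [|phi s IH] /=; first by rewrite valuation_Top.
by rewrite valuation_And // IH.
Qed.

Lemma theorem_derives Gamma phi : is_theorem L phi -> derives L Gamma phi.
Proof.
move=> thm; exists [::] => //; apply: th_MP thm _.
apply: tautology_theorem => v bv; rewrite !valuation_Imp //.
by case: (v phi) => //=; rewrite implybT.
Qed.

Lemma member_derives Gamma phi : Gamma phi -> derives L Gamma phi.
Proof.
move=> Gphi; exists [:: phi]; first by constructor.
apply: tautology_theorem => v bv.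
by rewrite valuation_Imp // valuation_Conj //= andbT implybb.
Qed.

Lemma derives_MP Gamma phi psi :
  derives L Gamma phi -> derives L Gamma (Imp phi psi) -> derives L Gamma psi.
Proof.
move=> [s Gs ts] [t Gt tt]; exists (s ++ t); first by apply/List.Forall_app.
apply: th_MP tt _; apply: th_MP ts _; apply: tautology_theorem => v bv.
rewrite !valuation_Imp // !valuation_Conj // all_cat.
by case: (all v s); case: (all v t); case: (v phi); case: (v psi).
Qed.

Lemma deduction Gamma phi psi :
  derives L (Gamma `|` [set phi]) psi -> derives L Gamma (Imp phi psi).
Proof.
case=> s; elim: s psi => [|chi s IH] psi Gs ts.
  apply: theorem_derives; apply: th_MP ts _; apply: tautology_theorem => v bv.
  rewrite !valuation_Imp // valuation_Conj //=.
  by case: (v phi); case: (v psi).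
have /IH {}IH : List.Forall (Gamma `|` [set phi]) s by inversion Gs.
have /IH : is_theorem L (Imp (Conj s) (Imp chi psi)).
  apply: th_MP ts _; apply: tautology_theorem => v bv.
  rewrite !valuation_Imp // !valuation_Conj //=.
  by case: (v chi); case: (all v s); case: (v psi).
have [Gchi | ->] : (Gamma `|` [set phi]) chi by inversion Gs.
- move=> d; apply: derives_MP (member_derives Gchi) _; apply: derives_MP d _.
  apply: theorem_derives; apply: tautology_theorem => v bv.
  by rewrite !valuation_Imp //; case: (v chi); case: (v phi); case: (v psi).
- move=> d; apply: derives_MP d _; apply: theorem_derives.
  apply: tautology_theorem => v bv.
  by rewrite !valuation_Imp //; case: (v phi); case: (v psi).
Qed.

Definition maximal_consistent D : Prop :=
  [/\ forall phi, is_theorem L phi -> D phi,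
      forall phi psi, D phi -> D (Imp phi psi) -> D psi &
      forall phi, D (Neg phi) <-> ~ D phi].

(** Zorn's lemma is applied to the extensions of [Gamma] that do not derive
    [phi]; it is used instead of an enumeration because the language is
    uncountable when the index set is. Maximality relative to [phi] already
    decides negations, since the underlying logic is classical. *)
Lemma Lindenbaum Gamma phi : ~ derives L Gamma phi ->
  exists D, [/\ maximal_consistent D, Gamma `<=` D & ~ D phi].
Proof.
move=> nd.
have [|A [nA maxA]] :=
    @Zorn_bigcup _ [set X | ~ derives L (Gamma `|` X) phi].
  move=> F Fnd Ftot /= [s Fs ts].
  (* The list is finite and the chain is total, so unless it uses [Gamma] only
     it uses a single member of the chain. *)
  have [Gs | [X FX Xs]] : List.Forall Gamma s \/
      exists2 X, F X & List.Forall (Gamma `|` X) s.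
    elim: Fs => {ts}[|psi t Dpsi _ [IH|[X FX IH]]]; first by left.
      case: Dpsi => [Gpsi|[X FX Xpsi]]; first by left; constructor.
      right; exists X => //; constructor; first by right.
      by apply: List.Forall_impl IH => ?; left.
    right; case: Dpsi => [Gpsi|[Y FY Ypsi]].
      by exists X => //; constructor => //; left.
    have [XY|YX] := Ftot _ _ FX FY.
      exists Y => //; constructor; first by right.
      by apply: List.Forall_impl IH => chi [?|/XY ?]; [left | right].
    by exists X => //; constructor => //; right; apply: YX.
  - by apply: nd; exists s.
  - by apply: (Fnd _ FX); exists s.
(* [A] need not contain [Gamma], so [A] itself may fail to be maximal
   consistent. *)
set D := Gamma `|` A.
have outD psi : ~ D psi -> derives L D (Imp psi phi).
  move=> nDpsi; apply: deduction; apply: contrapT => nd'.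
  apply: (maxA (A `|` [set psi])); last by rewrite /= setUA.
  split; first by left.
  by move=> /(_ psi (or_intror erefl)) ?; apply: nDpsi; right.
have closedD psi : derives L D psi -> D psi.
  by move=> d; apply: contrapT => /outD /(derives_MP d).
exists D; split; [split | by left | by move=> /member_derives].
- by move=> psi thm; apply: closedD; apply: theorem_derives.
- move=> psi chi Dpsi Dimp; apply: closedD.
  exact: derives_MP (member_derives Dpsi) (member_derives Dimp).
- move=> psi; split=> [Dn Dp | nDpsi].
    apply: nA; apply: derives_MP (member_derives Dp) _.
    apply: derives_MP (member_derives Dn) _; apply: theorem_derives.
    apply: tautology_theorem => v bv; rewrite !valuation_Imp //.
    by case: bv => _ -> _; case: (v psi); case: (v phi).
  apply: contrapT => /outD d; apply: nA; apply: derives_MP d _.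
  apply: derives_MP (outD _ nDpsi) _; apply: theorem_derives.
  apply: tautology_theorem => v bv; rewrite !valuation_Imp //.
  by case: bv => _ -> _; case: (v psi); case: (v phi).
Qed.

Section Member.
Variable D : set (formula P I).
Hypothesis mcsD : maximal_consistent D.

Lemma mcs_theorem phi : is_theorem L phi -> D phi.
Proof. by case: mcsD => + _ _; apply. Qed.

Lemma mcs_MP phi psi : is_theorem L (Imp phi psi) -> D phi -> D psi.
Proof. by case: mcsD => thm mp _ /thm i d; apply: mp d i. Qed.

Lemma mcs_Neg phi : D (Neg phi) <-> ~ D phi.
Proof. by case: mcsD. Qed.

Lemma mcs_Top : D (Top P I).
Proof. by apply: mcs_theorem; apply: tautology_theorem => v /valuation_Top. Qed.

Lemma mcs_Bot : ~ D Bot.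
Proof. by apply/mcs_Neg; apply: mcs_Top. Qed.

Lemma mcs_Or phi psi : D (Or phi psi) <-> D phi \/ D psi.
Proof.
have taut chi chi' : (forall v, boolean_valuation v -> v (Imp chi chi')) ->
    D chi -> D chi'.
  by move=> t; apply: mcs_MP; apply: tautology_theorem.
split=> [Dor | [|]].
- apply: contrapT => /not_orP[nphi]; apply.
  case: mcsD => _ mp _; apply: (mp (Neg phi)); first exact/mcs_Neg.
  apply: taut Dor => v bv; rewrite !valuation_Imp //.
  by case: bv => _ -> ->; case: (v phi); case: (v psi).
- apply: taut => v bv; rewrite valuation_Imp //.
  by case: bv => _ _ ->; case: (v phi).
- apply: taut => v bv; rewrite valuation_Imp //.
  by case: bv => _ _ ->; case: (v phi); case: (v psi).
Qed.

Lemma mcs_Imp phi psi : D (Imp phi psi) <-> (D phi -> D psi).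
Proof.
rewrite mcs_Or mcs_Neg; split=> [[//|//] | imp].
by have [/imp|] := pselect (D phi); [right | left].
Qed.

Lemma mcs_And phi psi : D (And phi psi) <-> D phi /\ D psi.
Proof.
rewrite mcs_Neg mcs_Or !mcs_Neg not_orE !notK; exact: iff_refl.
Qed.

End Member.

(** Theoremhood is thereby reduced to membership, which commutes with the
    connectives; propositional derivations can be replaced by reasoning about
    an arbitrary maximal consistent set. *)
Lemma mcs_all_theorem phi :
  (forall D, maximal_consistent D -> D phi) -> is_theorem L phi.
Proof.
move=> all; apply: contrapT => nthm.
have [|D [mcsD _]] := @Lindenbaum set0 phi; last by have := all _ mcsD.
move=> [[|psi s] s0 ts]; last by inversion s0.
apply: nthm; apply: th_MP ts; apply: tautology_theorem => v.
exact: valuation_Top.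
Qed.

End MaximalConsistent.

(** * Boxes in maximal consistent sets of extensions of B *)

Section BoxLaws.
Variables (P : countType) (I : choiceType) (CPL L : set (formula P I)).
Hypothesis cpl : cpl_axiomatization CPL.
Hypothesis extendsB : B_axiom CPL `<=` L.
Implicit Types (phi psi chi : formula P I) (G H K : group I).
Implicit Types (q : group I * formula P I).

Lemma tautology_theorem phi : tautology phi -> is_theorem L phi.
Proof.
move/(cpl phi).2; elim=> {phi}[phi ax | phi psi _ IH1 _ IH2].
  by apply: th_ax; apply: extendsB; apply: B0.
exact: th_MP IH1 IH2.
Qed.

(** Semantic counterpart of the theoremhood of [Imp phi psi], which it implies
    by [entails_theorem]. *)
Definition entails phi psi : Prop :=
  forall D, maximal_consistent L D -> D phi -> D psi.

Lemma entails_theorem phi psi : entails phi psi -> is_theorem L (Imp phi psi).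
Proof.
move=> ent; apply: (mcs_all_theorem tautology_theorem) => D mcsD.
by apply/(mcs_Imp tautology_theorem mcsD); apply: ent.
Qed.

Section BoxMember.
Variable D : set (formula P I).
Hypothesis mcsD : maximal_consistent L D.

Lemma box_RE G phi psi :
  entails phi psi -> entails psi phi -> D (Box G phi) -> D (Box G psi).
Proof.
move=> e1 e2; apply: (mcs_MP mcsD).
by apply: th_RE; apply: entails_theorem.
Qed.

Lemma box_AndU G H phi psi : (val G `&` val H)%fset = fset0 ->
  D (Box G phi) -> D (Box H psi) -> D (Box (groupU G H) (And phi psi)).
Proof.
move=> dGH DG DH; apply: (mcs_MP mcsD (th_ax (extendsB (B1 _ _ _ dGH)))).
exact/(mcs_And tautology_theorem mcsD).
Qed.

(** (B4) up to replacement of equivalents: [chi] is equivalent to [phi \/ chi]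
    when [phi] entails it. *)
Lemma box_absorb G H phi chi : entails phi chi ->
  D (Box G phi) -> D (Box H chi) -> D (Box (groupU G H) phi).
Proof.
move=> ent DG DH; apply: (mcs_MP mcsD (th_ax (extendsB (B4 _ G H phi chi)))).
apply/(mcs_And tautology_theorem mcsD); split=> //.
apply: box_RE DH => D' mcsD'.
  by move=> Dchi; apply/(mcs_Or tautology_theorem mcsD'); right.
by move=> /(mcs_Or tautology_theorem mcsD')[/(ent _ mcsD')|].
Qed.

(** (B3) for inclusions: a set of agents between [K] and [G] has the form
    [K `|` H], and [G] then has the form [K `|` H `|` J]. *)
Lemma box_between K H G phi :
  (val K `<=` val H)%fset -> (val H `<=` val G)%fset ->
  D (Box K phi) -> D (Box G phi) -> D (Box H phi).
Proof.
move=> KH HG DK DG.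
have HE : groupU K H = H by apply/val_inj/fsetUidPr.
have GE : groupU (groupU K H) G = G.
  by apply/val_inj; rewrite HE; apply/fsetUidPr.
rewrite -HE; apply: (mcs_MP mcsD (th_ax (extendsB (B3 _ K H G phi)))).
by apply/(mcs_And tautology_theorem mcsD); rewrite GE.
Qed.

Lemma box_Top_sub H G :
  (val H `<=` val G)%fset -> D (Box G (Top P I)) -> D (Box H (Top P I)).
Proof.
move=> HG; have {1}<- : groupU H G = G by apply/val_inj/fsetUidPr.
by apply: (mcs_MP mcsD); apply: th_ax; apply: extendsB; apply: B2.
Qed.

Lemma mcs_Conj_map (q : I -> group I * formula P I) (s : seq I) :
  D (Conj [seq (q i).2 | i <- s]) <-> forall i, i \in s -> D (q i).2.
Proof.
elim: s => [|i s IH] /=.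
  by split=> // _; apply: (mcs_Top tautology_theorem mcsD).
rewrite (mcs_And tautology_theorem mcsD) IH; split=> [[Di Ds] j | Ds].
  by rewrite inE => /orP[/eqP->|/Ds].
by split=> [|j js]; apply: Ds; rewrite inE ?eqxx ?js ?orbT.
Qed.

End BoxMember.

(** Indices with the same pair contribute an equivalent conjunct and the same
    group, so only distinct pairs have to be joined by (B1), and their groups
    are disjoint. The empty list is an exception because its union is not a
    group. *)
Lemma box_Conj_disjoint D (q : I -> group I * formula P I) (s : seq I) :
  maximal_consistent L D ->
  (forall i, i \in s -> D (Box (q i).1 (q i).2)) ->
  (forall i j, i \in s -> j \in s ->
     q i = q j \/ (val (q i).1 `&` val (q j).1)%fset = fset0) ->
  s = [::] \/ exists2 K : group I,
    (forall j, (j \in val K) = has (fun i => j \in val (q i).1) s) &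
    D (Box K (Conj [seq (q i).2 | i <- s])).
Proof.
move=> mcsD; elim: s => [|i s IH] Ds dis; first by left.
right; have Di : D (Box (q i).1 (q i).2) by apply: Ds; rewrite inE eqxx.
have sub j : j \in s -> j \in i :: s by move=> js; rewrite inE js orbT.
have [s0|[K KE DK]] : _ := IH (fun j js => Ds j (sub j js))
                             (fun j k js ks => dis j k (sub j js) (sub k ks)).
  rewrite s0; exists (q i).1 => [j|/=]; first by rewrite /= orbF.
  apply: (box_RE mcsD) Di => D' mcsD';
    rewrite (mcs_And tautology_theorem mcsD').
    by split=> //; apply: (mcs_Top tautology_theorem mcsD').
  by case.
have [[k ks qk]|new] := pselect (exists2 k, k \in s & q k = q i).
  exists K => [j|].
    rewrite KE /=; apply/idP/orP => [->|[ji|//]]; first by right.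
    by apply/hasP; exists k => //; rewrite qk.
  apply: (box_RE mcsD) DK => D' mcsD'; rewrite !(mcs_Conj_map mcsD') => D's j.
    by rewrite inE => /orP[/eqP->|]; [rewrite -qk; apply: D's | apply: D's].
  by move=> /sub; apply: D's.
exists (groupU (q i).1 K) => [j|]; first by rewrite in_fsetU KE.
apply: box_AndU => //; apply/fsetP => j; rewrite in_fsetI KE in_fset0.
apply/negP => /andP[ji /hasP[k ks jk]].
have [qE|d] := dis i k (mem_head i s) (sub k ks).
  by apply: new; exists k.
have : j \in (val (q i).1 `&` val (q k).1)%fset by rewrite in_fsetI ji jk.
by rewrite d.
Qed.

Lemma box_absorb_all D (q : I -> group I * formula P I) (s : seq I) K psi :
  maximal_consistent L D ->
  (forall i, i \in s -> D (Box (q i).1 (q i).2) /\ entails psi (q i).2) ->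
  D (Box K psi) ->
  exists G : group I, [/\ (val K `<=` val G)%fset,
    forall i, i \in s -> (val (q i).1 `<=` val G)%fset & D (Box G psi)].
Proof.
move=> mcsD + DK; elim: s => [|i s IH] Ds; first by exists K.
have [|G [KG sG DG]] := IH.
  by move=> j js; apply: Ds; rewrite inE js orbT.
have [Di ent] := Ds i (mem_head i s).
exists (groupU G (q i).1); split; last exact: box_absorb ent DG Di.
  by apply: fsubset_trans KG _; apply: fsubsetUl.
move=> j; rewrite inE => /orP[/eqP->|/sG]; first exact: fsubsetUr.
by move=> /fsubset_trans; apply; apply: fsubsetUl.
Qed.

(** * The canonical model *)

(** Selectors range independently of the formulas that hold, so that
    [component i (G, phi)] is undefinable by formulas when [G] has several
    members and [phi] is not a theorem. *)
Definition selector :=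
  {f : group I * formula P I -> I | forall q, f q \in val q.1}.

Definition canonical_world : Type :=
  ({D | maximal_consistent L D} * selector)%type.

Definition holds_at (w : canonical_world) : set (formula P I) := sval w.1.

Definition component (i : I) q : set canonical_world :=
  [set w | holds_at w q.2 \/ sval w.2 q <> i].

Definition canonical_nbhd (i : I) (w : canonical_world) :
    set (set canonical_world) :=
  [set X | exists q, [/\ i \in val q.1, holds_at w (Box q.1 q.2) &
                         X = component i q]].

Definition canonical_model (inh : inhabited canonical_world) : model P I :=
  Model inh canonical_nbhd (fun p => [set w | holds_at w (Var p)]).

Lemma holds_mcs w : maximal_consistent L (holds_at w).
Proof. exact: svalP w.1. Qed.

(** Selectors can be prescribed independently on all pairs; this is the freedom
    through which unwanted intersections are excluded. *)
Lemma selector_preferring (Q : group I * formula P I -> I -> Prop) :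
  exists f : selector, forall q i, i \in val q.1 -> Q q i -> Q q (sval f q).
Proof.
have [q|f fQ] := @choice _ _ (fun q i => i \in val q.1 /\
                     forall j, j \in val q.1 -> Q q j -> Q q i).
  have [[i iq Qi]|no] := pselect (exists2 i, i \in val q.1 & Q q i).
    by exists i.
  have /fset0Pn[i iq] := valP q.1.
  by exists i; split=> // j jq Qj; case: no; exists j.
by exists (exist _ f (fun q => (fQ q).1)) => q; apply: (fQ q).2.
Qed.

(** The heart of completeness: no intersection of components defines a formula
    unless the axioms of B force the corresponding box. *)
Lemma box_of_components D H (q : I -> group I * formula P I) psi :
  maximal_consistent L D ->
  (forall i, i \in val H ->
     i \in val (q i).1 /\ D (Box (q i).1 (q i).2)) ->
  (forall w, holds_at w psi <->
     forall i, i \in val H -> component i (q i) w) ->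
  D (Box H psi).
Proof.
move=> mcsD Hq psiE.
have entq i : i \in val H -> entails psi (q i).2.
  move=> iH D' mcsD' D'psi.
  (* With [f (q i) = i], the component of [i] contains the world only if its
     formula holds there. *)
  have [f fi] := selector_preferring (fun=> eq^~ i).
  have [|] := (psiE (exist _ D' mcsD', f)).1 D'psi i iH; first by [].
  by case; apply: (fi (q i) i (Hq i iH).1 erefl).
pose complete i := forall j, j \in val (q i).1 -> j \in val H /\ q j = q i.
pose s := [seq i <- val H | `[< complete i >]].
have sP i : i \in s <-> complete i /\ i \in val H.
  by rewrite mem_filter; split=> [/andP[/asboolP]|[/asboolP-> ->]].
have sH i : i \in s -> i \in val H by move/sP => [].
have ent_psi : entails (Conj [seq (q i).2 | i <- s]) psi.
  move=> D' mcsD' /(mcs_Conj_map mcsD') D's.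
  (* For incomplete [i] the selector names a member that does not pick [q i] as
     a member of [H], in particular not [i] itself. *)
  have [f fP] := selector_preferring (fun r j => ~ (j \in val H /\ q j = r)).
  apply: (psiE (exist _ D' mcsD', f)).2 => i iH.
  have [ci|] := pselect (complete i); first by left; apply: D's; apply/sP.
  move=> /existsNP[j /not_implyP[jq nj]]; right=> /= fi.
  by have := fP _ j jq nj; rewrite fi; apply.
(* The first alternative covers the case without complete members, where [K]
   is the group of an arbitrary pick and may exceed [H]. *)
have [K KH DK] : exists2 K : group I,
    s = [::] \/ (val K `<=` val H)%fset & D (Box K psi).
  have [|i j /sP[ci _] /sP[cj _]|s0|[K KE DK]] := @box_Conj_disjoint D q s mcsD.
  - by move=> i /sH/Hq[].
  - have [d|/fset0Pn[k]] := eqVneq (val (q i).1 `&` val (q j).1)%fset fset0.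
      by right.
    by rewrite in_fsetI => /andP[/ci[_ <-] /cj[_ <-]]; left.
  - have /fset0Pn[i iH] := valP H.
    exists (q i).1; first by left.
    apply: (box_RE mcsD) (Hq i iH).2; last exact: entq.
    move=> D' mcsD' _; apply: ent_psi => //.
    by rewrite s0; apply: (mcs_Top tautology_theorem mcsD').
  - exists K; first right.
      by apply/fsubsetP => j; rewrite KE => /hasP[i /sP[ci _] /ci[]].
    apply: (box_RE mcsD) DK => // D' mcsD' D'psi.
    by apply/(mcs_Conj_map mcsD') => i /sH iH; apply: entq.
have [|G [KG HqG DG]] := @box_absorb_all D q (val H) K psi mcsD _ DK.
  by move=> i iH; split; [case: (Hq i iH) | apply: entq].
have HG : (val H `<=` val G)%fset.
  by apply/fsubsetP => i iH; apply: (fsubsetP (HqG i iH)); case: (Hq i iH).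
case: KH => [s0|KH]; last exact: box_between KH HG DK DG.
have psiT : entails (Top P I) psi by rewrite s0 in ent_psi.
have Tpsi : entails psi (Top P I).
  by move=> D' mcsD' _; apply: (mcs_Top tautology_theorem mcsD').
apply: (box_RE mcsD psiT Tpsi); apply: (box_Top_sub mcsD HG).
exact: (box_RE mcsD Tpsi psiT).
Qed.

Lemma canonical_group_nbhd inh H psi (w : canonical_model inh) :
  group_nbhd H w [set v : canonical_model inh | holds_at v psi] <->
  holds_at w (Box H psi).
Proof.
split=> [[X NX psiE] | wH].
  have [i|q qP] := @choice _ _ (fun i q => i \in val H ->
      [/\ i \in val q.1, holds_at w (Box q.1 q.2) & X i = component i q]).
    have [iH|_] := boolP (i \in val H); last by exists (H, psi).
    by have [q qP] := NX i iH; exists q.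
  apply: (@box_of_components _ H q psi (holds_mcs w)) => [i /qP[]//|v].
  rewrite -[holds_at v psi]/([set v | holds_at v psi] v) psiE.
  by split=> vX i iH; have := vX i iH; case: (qP i iH) => _ _ ->.
(* The member of [H] named by the selector at [(H, psi)] forces [psi]. *)
exists (fun i => component i (H, psi)) => [i iH|]; first by exists (H, psi).
apply/seteqP; split=> [v vpsi i _ | v vX]; first by left.
have [//|] := vX (sval v.2 (H, psi)) (svalP v.2 (H, psi)).
by case.
Qed.

Lemma truth inh phi (w : canonical_model inh) : sat w phi <-> holds_at w phi.
Proof.
elim: phi w => [p||psi IH|psi1 IH1 psi2 IH2|H psi IH] w.
- by [].
- by split=> // /(mcs_Bot tautology_theorem (holds_mcs w)).
- by rewrite /= IH (mcs_Neg (holds_mcs w)).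
- by rewrite /= IH1 IH2 (mcs_Or tautology_theorem (holds_mcs w)).
- rewrite -canonical_group_nbhd /=.
  suff -> : [set v : canonical_model inh | sat v psi] =
            [set v : canonical_model inh | holds_at v psi] by [].
  by apply/seteqP; split=> v /IH.
Qed.

End BoxLaws.

(** * Strong completeness *)

Lemma derives_complete (P : countType) (I : choiceType)
    (CPL : set (formula P I)) (S : set condition) Gamma phi :
  cpl_axiomatization CPL -> consequence (model_class S) Gamma phi ->
  derives (extended_system CPL S) Gamma phi.
Proof.
move=> cpl cons; set L := extended_system CPL S.
have BL : B_axiom CPL `<=` L by left.
apply: contrapT => nd.
have [D [mcsD GD nD]] := Lindenbaum (tautology_theorem cpl BL) nd.
have [f _] := @selector_preferring P I (fun _ _ => True).
pose w : canonical_world L := (exist _ D mcsD, f).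
pose M := canonical_model (inhabits w).
have truthM psi (v : M) : sat v psi <-> holds_at v psi by exact: truth.
have SM : model_class S M.
  move=> c Sc; apply/condition_axiomP => i v; apply/truthM.
  apply: (mcs_theorem (holds_mcs v)); apply: th_ax.
  by right; exists c => //; exists i.
by apply: nD; apply/(truthM phi w)/cons => // psi /GD Dpsi; apply/truthM.
Qed.

Theorem theorem2 (P : countType) (I : choiceType) (CPL : set (formula P I))
    (S : set condition) :
  cpl_axiomatization CPL ->
  axiomatized_by (model_class S) (extended_system CPL S).
Proof.
move=> cpl Gamma phi; split; [exact: derives_sound | exact: derives_complete].
Qed.
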